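(* For a matroid $M$, the following statements are equivalent: (1) there are proper flats $F_1$, $F_2$, $F_3$ of $M$ with $|E(M)-(F_1\cup F_2\cup F_3)|\leq 2$; (2) $bw(M^t)\leq r(M^t)$ for all integers $t\geq 3$; (3) $bw(M^t)\leq r(M^t)$ for some integer $t\geq 3$. Consequently, if $E(M)$ is not the union of three proper flats of $M$ and a $2$-element subset of $E(M)$, then $bw(M^t)=r(M^t)+1$ for all $t\in\mathbb{N}$.
   Context: A cyclic flat of a matroid $M$ is a flat $F$ such that $M|F$ has no coloops; $\mathcal{Z}(M)$ denotes the set of cyclic flats, and a matroid is determined by its cyclic flats and their ranks. The $t$-expansion: fix $t\in\mathbb{N}$; for each $e\in E(M)$ let $S_e$ be a $t$-element set with $e\in S_e$, the sets $S_e$ pairwise disjoint; for $X\subseteq E(M)$ let $S_X=\bigcup_{e\in X}S_e$. The $t$-expansion $M^t$ is the matroid on $S_{E(M)}$ whose cyclic flats are exactly the sets $S_A$ with $A\in\mathcal{Z}(M)$, with $r_{M^t}(S_A)=t\cdot r_M(A)$. For $X\subseteq E(M)$ let $\overline{X}=E(M)-X$ and $\lambda_M(X)=r(X)+r(\overline{X})-r(M)$. A branch-decomposition of $M$ is a tree $T$ whose non-leaf vertices all have degree $3$, with an injection from $E(M)$ into the leaves of $T$; each edge $e$ displays the partition $(X,\overline{X})$ given by the labels on leaves of the two components of $T-e$, and has width $\lambda_M(X)+1$. The width of a branch-decomposition is its maximum edge width, and $bw(M)$ is the minimum width over all branch-decompositions of $M$.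
   Formalization: In the last sentence ''a 2-element subset'' is taken as ''a subset with at most 2 elements'' (the failure of (1)); with exactly 2 elements the claim is false for M = U_{1,1}, where bw(M^t) = 1 but r(M^t)+1 = t+1. *)

(* Defs.v *)
From mathcomp Require Import all_boot.
From mathcomp Require Import boolp.

Set Implicit Arguments.
Unset Strict Implicit.
Unset Printing Implicit Defensive.

(* A matroid whose ground set is the finite type [E], given by its rank
   function.  (Ground sets of several matroids are different finite types.) *)
Record matroid (E : finType) := Matroid {
  rk : {set E} -> nat;
  rk_card : forall X : {set E}, rk X <= #|X|;
  rk_mono : forall X Y : {set E}, X \subset Y -> rk X <= rk Y;
  rk_submod : forall X Y : {set E},
    rk (X :|: Y) + rk (X :&: Y) <= rk X + rk Y }.

Definition rank (E : finType) (M : matroid E) : nat := rk M [set: E].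

Definition flat (E : finType) (M : matroid E) (F : {set E}) : bool :=
  [forall x, (x \notin F) ==> (rk M F < rk M (x |: F))].

Definition proper_flat (E : finType) (M : matroid E) (F : {set E}) : bool :=
  flat M F && (F != [set: E]).

(* The restriction M|F has the rank function of [M], on the subsets of [F]. *)
Definition restriction_coloop (E : finType) (M : matroid E) (F : {set E})
    (x : E) : bool :=
  (x \in F) && (rk M (F :\ x) < rk M F).

Definition cyclic_flats (E : finType) (M : matroid E) : {set {set E}} :=
  [set F | flat M F & [forall x, ~~ restriction_coloop M F x]].

(* The subtraction does not truncate, by submodularity. *)
Definition connectivity (E : finType) (M : matroid E) (X : {set E}) : nat :=
  rk M X + rk M (~: X) - rank M.

Lemma rk_le_addD (E : finType) (M : matroid E) (A B : {set E}) :
  rk M A <= rk M B + #|A :\: B|.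
Proof.
apply: leq_trans (rk_mono M _) _; first exact: (subsetUr B A).
have -> : B :|: A = B :|: (A :\: B).
  by apply/setP => x; rewrite !inE; case: (x \in B).
apply: leq_trans (leq_addr (rk M (B :&: (A :\: B))) _) _.
by apply: leq_trans (rk_submod M _ _) _; rewrite leq_add2l rk_card.
Qed.

Lemma cyclic_flats_rank (E : finType) (M : matroid E) (X : {set E}) :
  exists2 A, A \in cyclic_flats M & rk M X = rk M A + #|X :\: A|.
Proof.
pose P B := rk M B + #|X :\: B| == rk M X.
pose pot (B : {set E}) := rk M B * #|E|.+1 + #|~: B|.
have PX : P X by rewrite /P setDv cards0 addn0.
have PE B : rk M B + #|X :\: B| <= rk M X -> P B.
  by move=> le; rewrite /P eqn_leq le rk_le_addD.
case: (arg_minnP pot PX) => A PA minA; exists A; last by rewrite (eqP PA).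
rewrite inE; apply/andP; split; apply/forallP => x.
  apply/implyP => xA; rewrite ltnNge; apply/negP => le.
  have lt : #|~: (x |: A)| < #|~: A|.
    apply: proper_card; rewrite properE setCS subsetUr /= setCS.
    by apply/negP => /subsetP/(_ x); rewrite !inE eqxx (negPf xA) => /(_ isT).
  have PxA : P (x |: A).
    apply: PE; rewrite -(eqP PA) leq_add //.
    by apply/subset_leq_card/setDS/subsetUr.
  have := minA _ PxA; rewrite leqNgt => /negP; apply; rewrite /pot.
  by apply: (leq_trans (n := rk M (x |: A) * #|E|.+1 + #|~: A|));
    rewrite ?ltn_add2l // leq_add2r leq_mul2r le orbT.
apply/negP => /andP[xA lt].
have PxA : P (A :\ x).
  apply: PE; rewrite -(eqP PA).
  apply: (leq_trans (n := rk M (A :\ x) + #|X :\: A|.+1)); last first.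
    by rewrite addnS -addSn leq_add2r.
  rewrite leq_add2l -add1n -(cards1 x).
  apply: leq_trans (subset_leq_card _) (leq_card_setU _ _).
  by apply/subsetP => y; rewrite !inE; case: eqVneq.
have := minA _ PxA; rewrite leqNgt => /negP; apply; rewrite /pot.
apply: (leq_trans (n := (rk M (A :\ x)).+1 * #|E|.+1)); last first.
  by rewrite (leq_trans _ (leq_addr _ _)) // leq_mul2r lt orbT.
by rewrite mulSn addnC ltn_add2r ltnS max_card.
Qed.

(* [E * 'I_t] is the ground set of the t-expansion: the t-element set S_e is
   [[set (e, i) | i : 'I_t]], and [blowup t A] is S_A, the union of the S_e
   for e in [A]. *)
Definition blowup (E : finType) (t : nat) (A : {set E}) : {set E * 'I_t} :=
  [set p | p.1 \in A].

Definition is_expansion (E : finType) (t : nat) (M : matroid E)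
    (N : matroid (E * 'I_t)%type) : Prop :=
  cyclic_flats N = [set blowup t A | A in cyclic_flats M] /\
  (forall A, A \in cyclic_flats M -> rk N (blowup t A) = t * rk M A).

Lemma is_expansion_uniq (E : finType) (t : nat) (M : matroid E)
    (N N' : matroid (E * 'I_t)%type) :
  is_expansion M N -> is_expansion M N' -> rk N =1 rk N'.
Proof.
suff le P Q X : is_expansion (t := t) M P -> is_expansion M Q ->
    rk P X <= rk Q X.
  by move=> hN hN' X; apply/eqP; rewrite eqn_leq !le.
move=> [_ rP] [zQ rQ]; have [C zC ->] := cyclic_flats_rank Q X.
move: zC; rewrite zQ => /imsetP[A zA ->]; rewrite rQ // -rP //; exact: rk_le_addD.
Qed.

(* Witness of existence: the rank function min_A (t * r(A) + |X - S_A|). *)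
Definition expansion_val (E : finType) (t : nat) (M : matroid E)
    (X : {set E * 'I_t}) (A : {set E}) : nat :=
  t * rk M A + #|X :\: blowup t A|.

Definition expansion_rk (E : finType) (t : nat) (M : matroid E)
    (X : {set E * 'I_t}) : nat :=
  expansion_val M X [arg min_(A < set0) expansion_val M X A].

Lemma expansion_rkP (E : finType) (t : nat) (M : matroid E)
    (X : {set E * 'I_t}) :
  (exists A, expansion_rk M X = expansion_val M X A) /\
  (forall A, expansion_rk M X <= expansion_val M X A).
Proof.
by rewrite /expansion_rk; case: arg_minnP => // A _ minA; split=> [|B];
  [exists A | apply: minA].
Qed.

Lemma expansion_rk_card (E : finType) (t : nat) (M : matroid E)
    (X : {set E * 'I_t}) : expansion_rk M X <= #|X|.
Proof.
apply: leq_trans ((expansion_rkP M X).2 set0) _.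
have := rk_card M set0; rewrite /expansion_val cards0 leqn0 => /eqP ->.
by rewrite muln0 subset_leq_card // subsetDl.
Qed.

Lemma expansion_rk_mono (E : finType) (t : nat) (M : matroid E)
    (X Y : {set E * 'I_t}) :
  X \subset Y -> expansion_rk M X <= expansion_rk M Y.
Proof.
move=> sXY; have [A ->] := (expansion_rkP M Y).1.
apply: leq_trans ((expansion_rkP M X).2 A) _.
by rewrite leq_add2l subset_leq_card // setSD.
Qed.

Lemma expansion_rk_submod (E : finType) (t : nat) (M : matroid E)
    (X Y : {set E * 'I_t}) :
  expansion_rk M (X :|: Y) + expansion_rk M (X :&: Y) <=
  expansion_rk M X + expansion_rk M Y.
Proof.
have [A ->] := (expansion_rkP M X).1; have [B ->] := (expansion_rkP M Y).1.
apply: leq_trans (leq_add ((expansion_rkP M _).2 (A :|: B))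
                          ((expansion_rkP M _).2 (A :&: B))) _.
rewrite /expansion_val addnACA [leqRHS]addnACA -!mulnDr leq_add //.
  by rewrite leq_mul2l rk_submod orbT.
rewrite -cardsUI -[leqRHS]cardsUI leq_add // subset_leq_card //;
  apply/subsetP => p; rewrite !inE;
  by case: (p \in X); case: (p \in Y); case: (p.1 \in A); case: (p.1 \in B).
Qed.

Definition expansion_matroid (E : finType) (t : nat) (M : matroid E) :=
  Matroid (@expansion_rk_card E t M) (@expansion_rk_mono E t M)
          (@expansion_rk_submod E t M).

Lemma card_blowup (E : finType) (t : nat) (A : {set E}) :
  #|blowup t A| = t * #|A|.
Proof.
have -> : blowup t A = setX A [set: 'I_t].
  by apply/setP => p; rewrite !inE andbT.
by rewrite cardsX cardsT card_ord mulnC.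
Qed.

Lemma blowupD (E : finType) (t : nat) (A B : {set E}) :
  blowup t A :\: blowup t B = blowup t (A :\: B).
Proof. by apply/setP => p; rewrite !inE. Qed.

Lemma expansion_rk_blowup (E : finType) (t : nat) (M : matroid E)
    (A : {set E}) : expansion_rk M (blowup t A) = t * rk M A.
Proof.
apply/eqP; rewrite eqn_leq; apply/andP; split.
  apply: leq_trans ((expansion_rkP M _).2 A) _.
  by rewrite /expansion_val setDv cards0 addn0.
have [B ->] := (expansion_rkP M (blowup t A)).1.
by rewrite /expansion_val blowupD card_blowup -mulnDr leq_mul2l rk_le_addD orbT.
Qed.

Lemma is_expansion_exists (E : finType) (t : nat) (M : matroid E) :
  exists N : matroid (E * 'I_t)%type, is_expansion M N.
Proof.
exists (expansion_matroid t M); split; last by move=> A _; exact: expansion_rk_blowup.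
apply/setP => F; apply/idP/imsetP; last first.
  move=> [A]; rewrite !inE => /andP[/forallP flA /forallP cyA] ->.
  apply/andP; split; apply/forallP => -[e i]; rewrite ?inE /=.
    apply/implyP => eA; rewrite expansion_rk_blowup.
    have t0 : 0 < t by apply: leq_ltn_trans (ltn_ord i).
    have [B ->] := (expansion_rkP M ((e, i) |: blowup t A)).1.
    have [eB|eB] := boolP (e \in B).
      have := flA e; rewrite eA /= => lt.
      apply: (leq_trans (n := t * rk M (e |: A))).
        by rewrite (leq_trans _ (_ : t * (rk M A).+1 <= _)) ?leq_mul2l ?lt ?orbT //
          mulnS -add1n leq_add2r.
      apply: (leq_trans (n := t * (rk M B + #|(e |: A) :\: B|))).
        by rewrite leq_mul2l rk_le_addD orbT.
      rewrite mulnDr leq_add2l -card_blowup -blowupD subset_leq_card //.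
      apply/subsetP => p; rewrite !inE => /andP[pB].
      rewrite pB /= => /orP[/eqP pe|->]; last by rewrite orbT.
      by rewrite pe eB in pB.
    apply: (leq_ltn_trans (n := t * (rk M B + #|A :\: B|))).
      by rewrite leq_mul2l rk_le_addD orbT.
    rewrite mulnDr ltn_add2l -card_blowup -blowupD proper_card // properE.
    rewrite setSD ?subsetUr //=; apply/negP => /subsetP/(_ (e, i)).
    by rewrite !inE eqxx /= eB (negPf eA) => /(_ isT).
  apply/negP => /andP[]; rewrite inE /= => eA; apply/negP; rewrite -leqNgt.
  rewrite expansion_rk_blowup.
  have := cyA e; rewrite /restriction_coloop eA /= -leqNgt => le.
  have [B ->] := (expansion_rkP M (blowup t A :\ (e, i))).1.
  have [eB|eB] := boolP (e \in B).
    apply: (leq_trans (n := t * (rk M B + #|A :\: B|))).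
      by rewrite leq_mul2l rk_le_addD orbT.
    rewrite mulnDr leq_add2l -card_blowup -blowupD subset_leq_card //.
    apply/subsetP => p; rewrite !inE => /andP[pB ->]; rewrite pB !andbT /=.
    by apply: contraNneq pB => ->.
  apply: (leq_trans (n := t * rk M (A :\ e))); first by rewrite leq_mul2l le orbT.
  apply: (leq_trans (n := t * (rk M B + #|(A :\ e) :\: B|))).
    by rewrite leq_mul2l rk_le_addD orbT.
  rewrite mulnDr leq_add2l -card_blowup -blowupD subset_leq_card //.
  apply/subsetP => p; rewrite !inE => /and3P[-> pe ->]; rewrite andbT /=.
  by apply: contraNneq pe => ->.
have [t0|t0] := posnP t.
  move=> _; have [A zA _] := cyclic_flats_rank M set0; exists A => //.
  by apply/setP => -[e i]; have := ltn_ord i; rewrite {2}t0.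
rewrite !inE => /andP[/forallP flF /forallP cyF].
have [B rB] := (expansion_rkP M F).1.
have sFB : F \subset blowup t B.
  apply/subsetP => p pF; apply: contraT => pB.
  have := cyF p; rewrite /restriction_coloop pF /= -leqNgt rB => le.
  have := leq_trans le ((expansion_rkP M _).2 B).
  rewrite leq_add2l leqNgt => /negP[]; apply: proper_card; rewrite properE.
  rewrite setSD ?subsetDl //=; apply/negP => /subsetP/(_ p).
  by rewrite in_setD pB pF => /(_ isT); rewrite !inE eqxx andbF.
have {}rB : expansion_rk M F = t * rk M B.
  rewrite rB /expansion_val; move: sFB; rewrite -setD_eq0 => /eqP ->.
  by rewrite cards0 addn0.
have flF' C : F \subset blowup t C -> rk M C <= rk M B -> blowup t C \subset F.
  move=> sFC le; apply/subsetP => p pC; apply: contraT => pF.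
  have := flF p; rewrite pF /= rB ltnNge => /negP[].
  apply: leq_trans (_ : expansion_rk M (blowup t C) <= _).
    by apply: expansion_rk_mono; rewrite subUset sub1set pC sFC.
  by rewrite expansion_rk_blowup leq_mul2l le orbT.
have eF : F = blowup t B by apply/eqP; rewrite eqEsubset sFB flF'.
exists B => //; rewrite inE; apply/andP; split; apply/forallP => e.
  apply/implyP => eB; rewrite ltnNge; apply/negP => le.
  have /subsetP/(_ (e, Ordinal t0)) : blowup t (e |: B) \subset F.
    apply: flF' => //; apply: subset_trans sFB _.
    by apply/subsetP => p; rewrite !inE => ->; rewrite orbT.
  by rewrite eF !inE eqxx (negPf eB) => /(_ isT).
apply/negP => /andP[eB lt].
have := cyF (e, Ordinal t0); rewrite /restriction_coloop eF inE /= eB /=.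
rewrite expansion_rk_blowup; case/negP.
apply: leq_ltn_trans ((expansion_rkP M _).2 (B :\ e)) _.
apply: (leq_trans (n := t * (rk M (B :\ e)).+1)); last first.
  by rewrite leq_mul2l lt orbT.
rewrite /expansion_val mulnSr ltn_add2l.
apply: (leq_trans (n := (#|blowup t [set e] :\ (e, Ordinal t0)|).+1)).
  rewrite ltnS subset_leq_card //; apply/subsetP => p; rewrite !inE.
  by case: (p.1 \in B); rewrite ?andbF // andbT negbK andbT andbC.
have := cardsD1 (e, Ordinal t0) (blowup t [set e]).
by rewrite card_blowup cards1 muln1 !inE eqxx add1n => <-.
Qed.

Definition expansion (E : finType) (t : nat) (M : matroid E) :
    matroid (E * 'I_t)%type :=
  sval (cid (is_expansion_exists t M)).

Lemma expansionP (E : finType) (t : nat) (M : matroid E) :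
  is_expansion M (expansion t M).
Proof. exact: svalP (cid (is_expansion_exists t M)). Qed.

(* A finite simple graph is a symmetric irreflexive relation.  A [ucycle] of
   size 2 only runs back and forth along one edge. *)
Definition is_tree (V : finType) (e : rel V) : Prop :=
  [/\ symmetric e, irreflexive e, 0 < #|V|, (forall x y, connect e x y) &
      forall c, ucycle e c -> size c <= 2].

Definition degree (V : finType) (e : rel V) (v : V) : nat := #|[set w | e v w]|.

Definition leaf (V : finType) (e : rel V) (v : V) : bool := degree e v == 1.

(* A branch-decomposition of a matroid on [E]; it depends on the ground set
   only.  Some leaves may carry no label. *)
Record branch_decomposition (E : finType) := BranchDecomposition {
  bd_vertex : finType;
  bd_edge : rel bd_vertex;
  bd_tree : is_tree bd_edge;
  bd_degree3 : forall v, ~~ leaf bd_edge v -> degree bd_edge v = 3;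
  bd_label : E -> bd_vertex;
  bd_label_inj : injective bd_label;
  bd_label_leaf : forall x, leaf bd_edge (bd_label x) }.

Definition delete_edge (V : finType) (e : rel V) (u v : V) : rel V :=
  [rel x y | [&& e x y, (x, y) != (u, v) & (x, y) != (v, u)]].

(* The labels in the component of T - uv that contains u.  The component of v
   gives the complement, which has the same connectivity. *)
Definition displayed (E : finType) (D : branch_decomposition E)
    (u v : bd_vertex D) : {set E} :=
  [set x | connect (delete_edge (@bd_edge E D) u v) u (bd_label D x)].

Definition width (E : finType) (M : matroid E) (D : branch_decomposition E) :
    nat :=
  \max_(p : bd_vertex D * bd_vertex D | bd_edge p.1 p.2)
     (connectivity M (displayed p.1 p.2)).+1.

(* Existence of branch-decompositions: replace a leaf by a vertex of degree 3
   with two new leaves until there are enough leaves. *)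
Definition grow (V : finType) (e : rel V) (l : V) : rel (V + bool) :=
  fun x y => match x, y with
    | inl a, inl b => e a b
    | inl a, inr _ => a == l
    | inr _, inl b => b == l
    | inr _, inr _ => false
    end.

Lemma ucycle_degree (V : finType) (e : rel V) (c : seq V) (x : V) :
  symmetric e -> ucycle e c -> 2 < size c -> x \in c ->
  exists y z, [/\ y != z, e x y & e x z].
Proof.
move=> esym /andP[cyc uniqc] szc xc.
case: (rot_to xc) => i s def_c.
have {cyc} : cycle e (x :: s) by rewrite -def_c rot_cycle.
have {uniqc} : uniq (x :: s) by rewrite -def_c rot_uniq.
have {szc} : 2 < size (x :: s) by rewrite -def_c size_rot.
case: s {def_c} => [|y s] //; case/lastP: s => [|s z] //= _.
rewrite mem_rcons inE rcons_path last_rcons => /and3P[_ + _].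
rewrite negb_or => /andP[yz _] /and3P[exy _ ezx].
by exists y, z; rewrite yz exy esym ezx.
Qed.

Lemma grow_tree (V : finType) (e : rel V) (l : V) :
  is_tree e -> is_tree (grow e l).
Proof.
case=> esym eirr V0 conn acyc.
have gsym : symmetric (grow e l) by case=> [a|a] [b|b] //=.
have csym := sym_connect_sym gsym.
have cl a : connect (grow e l) (inl a) (inl l).
  have /connectP[p pp ->] := conn a l.
  elim: p a pp => [|b p IH] a /=; first by rewrite connect0.
  case/andP=> ab /IH; apply: connect_trans; exact: connect1.
have cL x : connect (grow e l) x (inl l).
  by case: x => [a|b]; [exact: cl | apply: connect1; rewrite /= eqxx].
split=> //; first by case.
- by rewrite card_sum addn_gt0 V0.
- by move=> x y; apply: connect_trans (cL x) _; rewrite csym.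
move=> c uc; rewrite leqNgt; apply/negP => szc.
have cV x : x \in c -> exists a, x = inl a.
  case: x => [a|b] xc; first by exists a.
  have [[y|y] [[z|z] [yz]]] //= := ucycle_degree gsym uc szc xc.
  by move=> /eqP yl /eqP zl; rewrite yl zl eqxx in yz.
have [c' def_c] : exists c' : seq V, c = map inl c'.
  elim: c cV {uc szc} => [|x c IH] cV; first by exists [::].
  have [a ->] := cV x (mem_head _ _).
  have [|c' ->] := IH; last by exists (a :: c').
  by move=> y yc; apply: cV; rewrite inE yc orbT.
have : ucycle e c'.
  move: uc; rewrite def_c /ucycle => /andP[cyc uniqc].
  rewrite (map_uniq uniqc) andbT.
  case: c' cyc {def_c uniqc} => //= a s; rewrite -map_rcons.
  move: (rcons s a) => q; by elim: q a {s} => //= b q IH a /andP[-> /IH].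
by move/acyc; rewrite leqNgt; move: szc; rewrite def_c size_map => ->.
Qed.

Lemma grow_degree_inl (V : finType) (e : rel V) (l v : V) :
  degree (grow e l) (inl v) = degree e v + (v == l).*2.
Proof.
rewrite /degree !cardsE -!sum1_card big_sumType /=; congr (_ + _).
rewrite sum1_card; case: eqVneq => [->|nvl] /=.
  by rewrite -[RHS]card_bool; apply: eq_card => b; exact: (eqxx l).
by apply: eq_card0 => b; exact: (negPf nvl).
Qed.

Lemma grow_degree_inr (V : finType) (e : rel V) (l : V) (b : bool) :
  degree (grow e l) (inr b) = 1.
Proof.
rewrite /degree -(cards1 (inl l : V + bool)); apply: eq_card => -[a|a];
by rewrite !inE.
Qed.

Lemma cubic_tree_exists (n : nat) :
  exists V : finType, exists e : rel V,
    [/\ is_tree e, forall v, ~~ leaf e v -> degree e v = 3 &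
        n < #|[set v | leaf e v]|].
Proof.
elim: n => [|n [V [e [tree_e deg3 nle]]]].
  exists bool, (fun x y => x != y).
  have deg1 b : degree (fun x y : bool => x != y) b = 1.
    rewrite /degree -(cards1 (~~ b)); apply: eq_card => c; rewrite !inE.
    by case: b; case: c.
  split.
  - split; rewrite ?card_bool //.
    + by move=> x y; rewrite eq_sym.
    + by move=> x; rewrite eqxx.
    + by move=> x y; case: (eqVneq x y) => [->|xy]; [exact: connect0 | exact: connect1].
    + by move=> c /andP[_ /card_uniqP <-]; rewrite -card_bool max_card.
  - by move=> v; rewrite /leaf deg1.
  - by apply/card_gt0P; exists true; rewrite inE /leaf deg1.
have /card_gt0P[l] : 0 < #|[set v | leaf e v]| by apply: leq_trans nle.
rewrite inE => /eqP dl; exists (V + bool)%type, (grow e l); split.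
- exact: grow_tree.
- case=> [v|b]; rewrite /leaf ?grow_degree_inr // grow_degree_inl.
  by case: (eqVneq v l) => [->|_]; rewrite ?dl // double0 addn0; exact: deg3.
have lL : l \in [set v | leaf e v] by rewrite inE /leaf dl.
rewrite -(ltn_add2r 1) addn1 in nle.
apply: (leq_trans (n := #|[set v | leaf e v] :\ l| + 2)).
  by move: nle; rewrite (cardsD1 l) lL add1n addn1 addn2.
rewrite !cardsE -!sum1_card big_sumType /= leq_add //.
  rewrite !sum1_card; apply: subset_leq_card; apply/subsetP => v.
  case/andP; rewrite !inE => vl lv.
  suff : leaf (grow e l) (inl v) by [].
  by rewrite /leaf grow_degree_inl (negPf vl) double0 addn0.
rewrite sum1_card -card_bool; apply: subset_leq_card; apply/subsetP => b _.
suff : leaf (grow e l) (inr b) by [].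
by rewrite /leaf grow_degree_inr.
Qed.

Lemma branch_decomposition_exists (E : finType) (M : matroid E) :
  exists k, `[< exists D : branch_decomposition E, width M D = k >].
Proof.
have [V [e [te d3 nle]]] := cubic_tree_exists #|E|.
pose f (x : E) : V := enum_val (widen_ord (ltnW nle) (enum_rank x)).
have injf : injective f.
  move=> x y /enum_val_inj/(congr1 val)/= /ord_inj; exact: enum_rank_inj.
have leaff x : leaf e (f x).
  by have := enum_valP (widen_ord (ltnW nle) (enum_rank x)); rewrite inE.
exists (width M (BranchDecomposition te d3 injf leaff)).
by apply/asboolP; exists (BranchDecomposition te d3 injf leaff).
Qed.

Definition branch_width (E : finType) (M : matroid E) : nat :=
  ex_minn (branch_decomposition_exists M).

(* Main.v *)
Require Import Defs.
From mathcomp Require Import all_boot.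
From mathcomp Require Import boolp zify.

(** Call a set nonspanning when its rank is less than the full rank.  A set and
    its complement have connectivity less than the rank of the matroid exactly
    when one of the two is nonspanning.  If every edge of a
    branch-decomposition has a nonspanning side, orient it away from that side:
    some vertex of the tree is a sink, and the nonspanning sets at its at most
    three edges cover all elements but the one that may label the sink itself.
    Conversely, three nonspanning sets that cover the ground set can be hung on
    the three branches of a cubic tree at a common vertex.
    A set X is nonspanning in the t-expansion when, for some A, it has fewer
    than t * (r(M) - r(A)) elements outside S_A.  For three sets covering all
    but one element of M^t, counting clones therefore shows that the sets A
    miss fewer elements of M than the sum of their coranks, and all but two of
    these can be added to the sets A while keeping them nonspanning. *)

Set Implicit Arguments.
Unset Strict Implicit.
Unset Printing Implicit Defensive.

Lemma leq_card_bigcup (K T : finType) (A : K -> {set T}) :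
  #|\bigcup_k A k| <= \sum_k #|A k|.
Proof.
apply: (big_ind2 (fun (B : {set T}) n => #|B| <= n)) => //.
  by rewrite cards0.
by move=> B m C n leB leC; apply: leq_trans (leq_card_setU _ _) (leq_add _ _).
Qed.

Lemma leq_card_setC_bigcup (K T : finType) (X A : K -> {set T}) :
  #|~: \bigcup_k A k| <= \sum_k #|X k :\: A k| + #|~: \bigcup_k X k|.
Proof.
have sub : ~: (\bigcup_k A k) \subset
    \bigcup_k (X k :\: A k) :|: ~: \bigcup_k X k.
  apply/subsetP => x; rewrite in_setU !in_setC orbC -implybE => xA.
  apply/implyP => /bigcupP[k _ xX]; apply/bigcupP; exists k => //.
  by rewrite in_setD xX andbT; apply: contra xA => xAk; apply/bigcupP; exists k.
apply: leq_trans (subset_leq_card sub) _.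
apply: leq_trans (leq_card_setU _ _) _.
by rewrite leq_add2r leq_card_bigcup.
Qed.

Lemma card_le_add_split (T : finType) (R : {set T}) (a b : nat) :
  #|R| <= a + b -> exists2 B : {set T}, #|B| <= a & #|R :\: B| <= b.
Proof.
move=> leR.
have /card_gt0P[B] :
    0 < #|[set B : {set T} | B \subset R & #|B| == minn a #|R| ]|.
  by rewrite cards_draws bin_gt0 geq_minr.
rewrite inE => /andP[sBR /eqP cardB].
by exists B; rewrite ?cardsDS // cardB; lia.
Qed.

Lemma card_le_sum_split (K T : finType) (R : {set T}) (a : K -> nat) (m : nat) :
  #|R| <= \sum_k a k + m ->
  exists2 B : K -> {set T}, (forall k, #|B k| <= a k) &
    #|R :\: \bigcup_k B k| <= m.
Proof.
elim: (index_enum K) (index_enum_uniq K) R => [|k s IH] /= uniq_s R.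
  by rewrite !big_nil => leR; exists (fun=> set0);
    rewrite ?big_nil ?setD0 ?cards0.
rewrite big_cons -addnA => /card_le_add_split[Bk leBk].
case/andP: uniq_s => ks uniq_s /(IH uniq_s)[B leB leR].
exists (fun i => if i == k then Bk else B i) => [i|].
  by case: eqP => [->|].
rewrite big_cons eqxx -setDDl (eq_big_seq B) // => i si.
by case: eqP => // ik; rewrite -ik si in ks.
Qed.

Lemma extend_almost_cover (K T : finType) (A : K -> {set T}) (a : K -> nat)
    (m : nat) :
  #|~: \bigcup_k A k| <= \sum_k a k + m ->
  exists2 B : K -> {set T}, (forall k, #|B k| <= a k) &
    #|~: \bigcup_k (A k :|: B k)| <= m.
Proof.
move/card_le_sum_split => [B leB leR]; exists B => //.
by rewrite big_split setCU -setDE.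
Qed.

Lemma color_preserving_injection (S T K : finType) (L : pred T)
    (cS : S -> K) (cT : T -> K) :
  (forall k, #|[set x | cS x == k]| <= #|[set y | L y & cT y == k]|) ->
  exists2 f : S -> T, injective f & forall x, L (f x) /\ cT (f x) = cS x.
Proof.
pose color_class k := enum [set x | cS x == k].
pose targets k := enum [set y | L y & cT y == k] => leST.
have index_lt x : index x (color_class (cS x)) < size (targets (cS x)).
  rewrite -cardE; apply: leq_trans (leST _).
  by rewrite cardE index_mem mem_enum inE.
have target_exists x : exists y, y \in targets (cS x).
  have : 0 < size (targets (cS x)) by apply: leq_ltn_trans (index_lt x).
  by case: (targets (cS x)) => // y s _; exists y; apply: mem_head.
have [default _] := fin_all_exists target_exists.
pose f x := nth (default x) (targets (cS x)) (index x (color_class (cS x))).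
have fP x : L (f x) /\ cT (f x) = cS x.
  have := mem_nth (default x) (index_lt x).
  by rewrite -/(f x) mem_enum inE => /andP[-> /eqP].
exists f => // x y eq_f.
have eq_color : cS x = cS y by rewrite -(fP x).2 -(fP y).2 eq_f.
have index_x_lt := index_lt x; rewrite eq_color in index_x_lt.
move/eqP: eq_f; rewrite /f eq_color (set_nth_default (default y)) //.
rewrite nth_uniq ?enum_uniq // => /eqP/(index_inj x); apply;
  by rewrite mem_enum inE ?eq_color.
Qed.

Definition component (V : finType) (e : rel V) (u v : V) : {set V} :=
  [set x | connect (delete_edge e u v) u x].

Section Components.

Variables (V : finType) (e : rel V).

Lemma delete_edgeC (u v : V) : delete_edge e u v =2 delete_edge e v u.
Proof. by move=> x y /=; congr (_ && _); rewrite andbC. Qed.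

Lemma delete_edge_sym (u v : V) :
  symmetric e -> symmetric (delete_edge e u v).
Proof.
move=> sym_e x y; rewrite /delete_edge /= sym_e !xpair_eqE; congr (_ && _).
by rewrite andbC (andbC (y == v)) (andbC (y == u)).
Qed.

Lemma delete_edge_avoiding (u v x y : V) :
  x != u -> y != u -> delete_edge e u v x y = e x y.
Proof.
move=> /negPf xu /negPf yu; rewrite /delete_edge /= !xpair_eqE xu yu.
by rewrite andbF !andbT.
Qed.

Lemma component_refl (u v : V) : u \in component e u v.
Proof. by rewrite inE connect0. Qed.

Lemma component_connect (u v x y : V) :
  x \in component e u v -> delete_edge e u v x y -> y \in component e u v.
Proof. by rewrite !inE => ux xy; apply: connect_trans ux (connect1 xy). Qed.

Lemma component_step (u v x y : V) :
  x \in component e u v -> e x y -> y != v -> y \in component e u v.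
Proof.
move=> ux exy /negPf yv; have [-> | yu] := eqVneq y u.
  exact: component_refl.
by apply: component_connect ux _; rewrite /delete_edge /= exy !xpair_eqE yv
  (negPf yu) !andbF.
Qed.

Lemma component_ind (u v : V) (P : V -> Prop) :
  P u ->
  (forall x y, x \in component e u v -> y \in component e u v ->
     delete_edge e u v x y -> P x -> P y) ->
  forall x, x \in component e u v -> P x.
Proof.
move=> Pu step x; rewrite inE => /connectP[p pp ->].
elim/last_ind: p pp => [|p y IH] //=.
rewrite rcons_path last_rcons => /andP[pp zy].
have uz : last u p \in component e u v by rewrite inE; apply/connectP; exists p.
exact: step uz (component_connect uz zy) zy (IH pp).
Qed.

End Components.

Section Trees.

Variables (V : finType) (e : rel V).
Hypothesis tree_e : is_tree e.

Lemma tree_sym : symmetric e.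
Proof. by case: tree_e. Qed.

Lemma tree_edge_neq (u v : V) : e u v -> u != v.
Proof.
by case: tree_e => _ irr _ _ _; apply: contraTneq => ->; rewrite irr.
Qed.

Lemma tree_closed_full (A : {set V}) (u : V) :
  u \in A -> (forall x y, e x y -> x \in A -> y \in A) -> A = setT.
Proof.
move=> uA step; apply/setP => x; rewrite in_setT -uA.
case: tree_e => _ _ _ conn _; symmetry; apply: closed_connect (conn u x).
by apply: intro_closed step; apply: sym_connect_sym tree_sym.
Qed.

Lemma notin_component (u v : V) : e u v -> v \notin component e u v.
Proof.
case: tree_e => _ _ _ _ acyc euv; apply/negP; rewrite inE.
case/connectP=> p pp; case: (shortenP pp) => q pq uq _ lq.
have : ucycle e (u :: q).
  rewrite /ucycle uq andbT /= rcons_path -lq tree_sym euv andbT.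
  by apply: sub_path pq => x y /andP[].
move/acyc; case: q pq uq lq => [|x [|y q]] //=.
  by move=> _ _ vu; have := tree_edge_neq euv; rewrite vu eqxx.
by rewrite /delete_edge /= andbT => + _ vx; rewrite -vx eqxx /= andbF.
Qed.

Lemma componentC (u v : V) : e u v -> ~: component e u v = component e v u.
Proof.
move=> euv.
have cover : component e u v :|: component e v u = setT.
  apply: (@tree_closed_full _ u) => [|x y exy].
    by rewrite inE component_refl.
  rewrite !in_setU; case/orP => xC.
    have [->|yv] := eqVneq y v; first by rewrite component_refl orbT.
    by rewrite (component_step xC exy yv).
  have [->|yu] := eqVneq y u; first by rewrite component_refl.
  by rewrite (component_step xC exy yu) orbT.
apply/setP => x; rewrite in_setC; apply/idP/idP => [xC|].
  by have /setP/(_ x) := cover; rewrite !in_setU in_setT (negPf xC).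
have csym := sym_connect_sym (delete_edge_sym u v tree_sym).
rewrite inE (eq_connect (delete_edgeC e v u)) => vx.
apply: contra (notin_component euv); rewrite !inE => ux.
by rewrite (connect_trans ux) // csym.
Qed.

Lemma neighbor_components_cover (u x : V) :
  x != u -> exists2 w, e u w & x \in component e w u.
Proof.
pose A := u |: \bigcup_(w | e u w) component e w u => xu.
have : x \in A.
  rewrite (@tree_closed_full A u) ?inE ?eqxx // => y z eyz.
  rewrite !in_setU1; have [//|zu] := eqVneq z u.
  case/orP => [/eqP yu | /bigcupP[w euw yw]]; apply/bigcupP.
    by rewrite yu in eyz; exists z => //; apply: component_refl.
  by exists w => //; apply: component_step eyz zu.
by rewrite in_setU1 (negPf xu) => /bigcupP[w]; exists w.
Qed.

Lemma component_proper (u v w : V) :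
  e u v -> e u w -> w != v -> component e w u \proper component e u v.
Proof.
move=> euv euw wv; have ewu : e w u by rewrite tree_sym.
rewrite properE; apply/andP; split; last first.
  apply/negP => /subsetP/(_ u (component_refl e u v)).
  exact/negP/notin_component.
apply/subsetP; apply: component_ind => [|x y xC yC xy ux].
  exact: component_step (component_refl e u v) euw wv.
have avoid z : z \in component e w u -> z != u.
  by apply: contraTneq => ->; apply: notin_component.
apply: component_connect ux _; rewrite delete_edge_avoiding ?avoid //.
by case/andP: xy.
Qed.

Lemma tree_sink (small : rel V) :
  (forall u v, e u v -> small u v || small v u) ->
  exists u, forall w, e u w -> small w u.
Proof.
move=> small_side; pose large (p : V * V) := e p.1 p.2 && ~~ small p.1 p.2.
have [/existsP[p0 large_p0]|no_large] := boolP [exists p, large p]; last first.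
  case: (tree_e) => _ _ /card_gt0P[u _] _ _; exists u => w euw.
  apply: contraR no_large => nsmall; apply/existsP; exists (w, u).
  by rewrite /large /= tree_sym euw.
case: (arg_minnP (fun p => #|component e p.1 p.2|) large_p0) => -[u v].
move=> /andP[/= euv large_uv] min_uv; exists u => w euw.
have [->|wv] := eqVneq w v.
  by have := small_side _ _ euv; rewrite (negPf large_uv).
apply: contraT => large_wu.
have := min_uv (w, u); rewrite /large /= tree_sym euw large_wu => /(_ isT).
by rewrite leqNgt (proper_card (component_proper euv euw wv)).
Qed.

End Trees.

Definition nonspanning (E : finType) (M : matroid E) (X : {set E}) : bool :=
  rk M X < rank M.

Definition corank (E : finType) (M : matroid E) (X : {set E}) : nat :=
  rank M - rk M X.

Definition covered_up_to (K E : finType) (P : pred {set E}) (m : nat) : Prop :=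
  exists2 X : K -> {set E}, (forall k, P (X k)) & #|~: \bigcup_k X k| <= m.

Section Matroid.

Variables (E : finType) (M : matroid E).

Lemma rk_le_rank (X : {set E}) : rk M X <= rank M.
Proof. by apply: rk_mono; apply: subsetT. Qed.

Lemma rk_setU_card (A B : {set E}) : rk M (A :|: B) <= rk M A + #|B|.
Proof.
apply: leq_trans (rk_le_addD M _ A) _; rewrite leq_add2l subset_leq_card //.
by rewrite setDUl setDv set0U subsetDl.
Qed.

Lemma nonspanning_sub (X Y : {set E}) :
  X \subset Y -> nonspanning M Y -> nonspanning M X.
Proof. by move/(rk_mono M); apply: leq_ltn_trans. Qed.

Lemma corank_gt0 (X : {set E}) : (0 < corank M X) = nonspanning M X.
Proof. exact: subn_gt0. Qed.

Lemma nonspanning_setU (A B : {set E}) :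
  #|B| < corank M A -> nonspanning M (A :|: B).
Proof. by rewrite /corank /nonspanning; have := rk_setU_card A B; lia. Qed.

Lemma proper_flat_nonspanning (F : {set E}) :
  proper_flat M F -> nonspanning M F.
Proof.
case/andP=> /forallP flat_F; rewrite -subTset => /subsetPn[x _ xF].
by have := flat_F x; rewrite xF => /leq_trans; apply; apply: rk_le_rank.
Qed.

Lemma nonspanning_proper_flat (A : {set E}) :
  nonspanning M A -> exists2 F, proper_flat M F & A \subset F.
Proof.
case/maxset_exists=> F /maxsetP[nsF maxF] sAF; exists F => //.
apply/andP; split; last first.
  by apply: contraTneq nsF => ->; rewrite /nonspanning ltnn.
apply/forallP => x; apply/implyP => xF; apply: leq_trans nsF _.
rewrite leqNgt; apply: contra xF => nsxF.
by rewrite -(maxF _ nsxF (subsetUr _ _)) setU11.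
Qed.

Lemma connectivity_le_rank (X : {set E}) : connectivity M X <= rank M.
Proof.
by rewrite /connectivity; have := rk_le_rank X; have := rk_le_rank (~: X); lia.
Qed.

Lemma connectivity_lt_rank (X : {set E}) :
  (connectivity M X < rank M) = nonspanning M X || nonspanning M (~: X).
Proof.
rewrite /connectivity /nonspanning.
by have := rk_le_rank X; have := rk_le_rank (~: X); lia.
Qed.

Lemma proper_flat_cover_of_corank (K : finType) (A : K -> {set E}) :
  (forall k, nonspanning M (A k)) ->
  #|~: \bigcup_k A k| < \sum_k corank M (A k) ->
  covered_up_to K (proper_flat M) #|K|.-1.
Proof.
move=> nsA missed.
have sum_corank :
    \sum_k corank M (A k) = \sum_k (corank M (A k)).-1 + #|K|.
  rewrite -sum1_card -big_split; apply: eq_bigr => k _ /=.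
  by rewrite addn1 prednK // corank_gt0.
have [|B leB leAB] := @extend_almost_cover K _ A
    (fun k => (corank M (A k)).-1) #|K|.-1.
  by move: missed; rewrite sum_corank; lia.
have flat_above k : exists F, proper_flat M F /\ A k :|: B k \subset F.
  have [|F] := @nonspanning_proper_flat (A k :|: B k); last by exists F.
  apply: nonspanning_setU; have := nsA k; rewrite -corank_gt0.
  by have := leB k; lia.
have [F FP] := fin_all_exists flat_above.
exists F => [k|]; first exact: (FP k).1.
apply: leq_trans leAB; rewrite subset_leq_card // setCS.
by apply/bigcupsP => k _; apply: bigcup_max (FP k).2.
Qed.

Lemma three_proper_flatsP (m : nat) :
  (exists F1 F2 F3, [/\ proper_flat M F1, proper_flat M F2, proper_flat M F3
     & #|[set: E] :\: (F1 :|: F2 :|: F3)| <= m]) <->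
  covered_up_to 'I_3 (proper_flat M) m.
Proof.
have union3 (F : 'I_3 -> {set E}) :
    \bigcup_k F k = F ord0 :|: F (inord 1) :|: F (inord 2).
  rewrite !big_ord_recl big_ord0 setU0 setUA.
  by congr (_ :|: F _ :|: F _); apply: val_inj; rewrite /= inordK.
split=> [[F1 [F2 [F3 [pf1 pf2 pf3]]]] | [F pfF]].
  rewrite setTD => missed; exists (fun k : 'I_3 => nth set0 [:: F1; F2; F3] k).
    by case=> -[|[|[|]]].
  by rewrite union3 /= !inordK.
rewrite union3 => missed; exists (F ord0), (F (inord 1)), (F (inord 2)).
by rewrite setTD.
Qed.

End Matroid.

Section BranchWidth.

Variables (E : finType) (N : matroid E).

Lemma displayed_component (D : branch_decomposition E) (u v : bd_vertex D) x :
  (x \in displayed u v) = (bd_label D x \in component (@bd_edge E D) u v).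
Proof. by rewrite !inE. Qed.

Lemma displayedC (D : branch_decomposition E) (u v : bd_vertex D) :
  bd_edge u v -> ~: displayed u v = displayed v u.
Proof.
move=> euv; apply/setP => x.
by rewrite in_setC !displayed_component -(componentC (bd_tree D) euv) in_setC.
Qed.

Lemma bd_degree_bounds (D : branch_decomposition E) (u : bd_vertex D) :
  0 < degree (@bd_edge E D) u <= 3.
Proof.
by have [/eqP ->|/bd_degree3 ->] := boolP (leaf (@bd_edge E D) u).
Qed.

Lemma displayed_neighbors_cover (D : branch_decomposition E) (u : bd_vertex D) :
  #|~: \bigcup_(w | bd_edge u w) displayed w u| <= 1.
Proof.
apply/card_le1_eqP => x y.
suff label_u (z : E) :
    z \in ~: (\bigcup_(w | bd_edge u w) displayed w u) -> bd_label D z = u.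
  by move=> /label_u xu /label_u yu; apply: (@bd_label_inj _ D); rewrite xu.
rewrite in_setC => z_missed; apply/eqP; apply: contraR z_missed.
case/(neighbor_components_cover (bd_tree D)) => w euw zw.
by apply/bigcupP; exists w; rewrite // displayed_component.
Qed.

Lemma width_le_rankP (D : branch_decomposition E) :
  reflect (forall u v : bd_vertex D, bd_edge u v ->
             nonspanning N (displayed u v) || nonspanning N (displayed v u))
    (width N D <= rank N).
Proof.
rewrite /width; apply: (iffP (bigmax_leqP _ _ _)).
  move=> leN u v euv.
  by rewrite -(displayedC euv) -connectivity_lt_rank (leN (u, v)).
move=> sides [u v] /= euv.
by rewrite connectivity_lt_rank displayedC ?sides.
Qed.

Lemma branch_width_leP (k : nat) :
  branch_width N <= k <-> exists D : branch_decomposition E, width N D <= k.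
Proof.
rewrite /branch_width; case: ex_minnP => b /asboolP[D widthD] min_b.
split=> [leb | [D' leD']]; first by exists D; rewrite widthD.
by apply: leq_trans leD'; apply: min_b; apply/asboolP; exists D'.
Qed.

Lemma branch_width_le_rankS : branch_width N <= (rank N).+1.
Proof.
have [D leD] := (branch_width_leP _).1 (leqnn (branch_width N)).
apply/branch_width_leP; exists D; apply/bigmax_leqP => p _.
by rewrite ltnS connectivity_le_rank.
Qed.

Lemma nonspanning_cover_of_branch_width :
  branch_width N <= rank N -> covered_up_to 'I_3 (nonspanning N) 1.
Proof.
case/branch_width_leP => D /width_le_rankP sides.
have [u sink_u] := tree_sink (bd_tree D) sides.
have /andP[/card_gt0P[w0 +]] := bd_degree_bounds u; rewrite inE => euw0.
rewrite /degree cardE; set nbrs := enum _ => le3.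
have mem_nbrs w : (w \in nbrs) = bd_edge u w by rewrite mem_enum inE.
exists (fun k : 'I_3 => displayed (nth w0 nbrs k) u) => [k|].
  apply: sink_u; have [lt_k|ge_k] := ltnP k (size nbrs).
    by rewrite -mem_nbrs mem_nth.
  by rewrite nth_default.
apply: leq_trans (displayed_neighbors_cover u).
rewrite subset_leq_card // setCS; apply/bigcupsP => w; rewrite -mem_nbrs => wn.
have lt_w : index w nbrs < 3 by apply: leq_trans le3; rewrite index_mem.
by apply: (bigcup_max (Ordinal lt_w)); rewrite //= nth_index.
Qed.

End BranchWidth.

Definition cubic (V : finType) (e : rel V) : Prop :=
  forall v, ~~ leaf e v -> degree e v = 3.

Definition colored_leaves (K V : finType) (e : rel V) (c : V -> K) (k : K) :
    {set V} :=
  [set v | leaf e v & c v == k].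

(* For a tree: [c] is constant on each branch at [z].  The color of [z] itself
   does not matter. *)
Definition constant_off (K : Type) (V : finType) (z : V) (e : rel V)
    (c : V -> K) : Prop :=
  forall x y, x != z -> y != z -> e x y -> c x = c y.

Lemma constant_off_component (K : Type) (V : finType) (z u v : V) (e : rel V)
    (c : V -> K) :
  constant_off z e c -> z \notin component e u v ->
  forall x, x \in component e u v -> c x = c u.
Proof.
move=> const_c zC; apply: component_ind => // x y xC yC /andP[exy _] <-.
have off_z w : w \in component e u v -> w != z by apply: contraTneq => ->.
by apply/esym/const_c; rewrite ?off_z.
Qed.

Definition claw (K : finType) : rel (option K) :=
  fun x y => (x == None) (+) (y == None).

Lemma claw_tree (K : finType) : is_tree (@claw K).
Proof.
have csym : symmetric (@claw K) by move=> x y; rewrite /claw addbC.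
have conn_None x : connect (@claw K) x None.
  by case: x => [k|]; [exact: connect1 | exact: connect0].
split=> //; first by move=> x; rewrite /claw addbb.
- by rewrite card_option.
- move=> x y; apply: connect_trans (conn_None x) _.
  by rewrite (sym_connect_sym csym).
move=> c cycle_c; rewrite leqNgt; apply/negP => size_c.
have sub_None : {subset c <= [:: None]}.
  by case=> [k|] // /(ucycle_degree csym cycle_c size_c)[[y|] [[z|] []]].
have /andP[_ uniq_c] := cycle_c; have := uniq_leq_size uniq_c sub_None.
by rewrite leqNgt (ltn_trans _ size_c).
Qed.

Lemma claw_degree_None (K : finType) : degree (@claw K) None = #|K|.
Proof.
rewrite /degree cardsE -[RHS]/(#|K|.+1.-1) -card_option -(cardC1 None).
by apply: eq_card => -[].
Qed.

Lemma claw_degree_Some (K : finType) (k : K) : degree (@claw K) (Some k) = 1.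
Proof.
rewrite /degree -(cards1 (None : option K)); apply: eq_card => x.
by rewrite !inE /claw.
Qed.

Section Grow.

Variables (K V : finType) (e : rel V) (l : V).
Hypothesis leaf_l : leaf e l.

Definition grow_origin (x : V + bool) : V := if x is inl v then v else l.

Definition grow_leaf (v : V) : V + bool := if v == l then inr false else inl v.

Lemma grow_leafK : cancel grow_leaf grow_origin.
Proof. by move=> v; rewrite /grow_leaf; case: eqP. Qed.

Lemma leaf_grow_leaf (v : V) : leaf (grow e l) (grow_leaf v) = leaf e v.
Proof.
rewrite /grow_leaf; case: eqVneq => [->|/negPf vl]; rewrite /leaf.
  by rewrite grow_degree_inr (eqP leaf_l).
by rewrite grow_degree_inl vl addn0.
Qed.

Lemma grow_cubic : cubic e -> cubic (grow e l).
Proof.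
move=> cubic_e [v|b]; rewrite /leaf ?grow_degree_inr // grow_degree_inl.
have [->|_] := eqVneq v l; first by rewrite (eqP leaf_l).
by rewrite double0 addn0; apply: cubic_e.
Qed.

Lemma grow_constant_off (z : V) (c : V -> K) :
  constant_off z e c -> constant_off (inl z) (grow e l) (c \o grow_origin).
Proof.
move=> const_c [x|b] [y|b'] //= xz yz; first exact: const_c.
  by move/eqP=> ->.
by move/eqP=> ->.
Qed.

Lemma card_grow_colored_leaves (c : V -> K) (k : K) :
  (c l == k) + #|colored_leaves e c k| <=
  #|colored_leaves (grow e l) (c \o grow_origin) k|.
Proof.
have leaf_inr b : leaf (grow e l) (inr b) by rewrite /leaf grow_degree_inr.
set L := colored_leaves (grow e l) _ k.
have old_leaves : grow_leaf @: colored_leaves e c k \subset L.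
  apply/subsetP => _ /imsetP[v + ->]; rewrite !inE /= grow_leafK.
  by rewrite leaf_grow_leaf.
rewrite -(card_imset _ (can_inj grow_leafK)).
have [clk|_] := eqVneq (c l) k; last exact: subset_leq_card old_leaves.
have new_leaf : inr true \notin grow_leaf @: colored_leaves e c k.
  by apply/imsetP => -[v _]; rewrite /grow_leaf; case: eqP.
have := cardsU1 (inr true) (grow_leaf @: colored_leaves e c k).
rewrite new_leaf => <-; rewrite subset_leq_card //.
by rewrite subUset sub1set old_leaves !inE leaf_inr /= clk eqxx.
Qed.

End Grow.

Lemma colored_cubic_tree_exists (s : seq 'I_3) :
  exists (V : finType) (e : rel V) (z : V) (c : V -> 'I_3),
    [/\ is_tree e, cubic e, constant_off z e c
      & forall k, count_mem k s < #|colored_leaves e c k|].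
Proof.
elim: s => [|k s [V [e [z [c [tree_e cubic_e const_c leaves]]]]]].
  exists (option 'I_3), (@claw _), None, (odflt ord0); split.
  - exact: claw_tree.
  - case=> [k|]; first by rewrite /leaf claw_degree_Some.
    by rewrite claw_degree_None card_ord.
  - by case=> [i|] [j|].
  - move=> k; apply/card_gt0P; exists (Some k).
    by rewrite !inE /leaf claw_degree_Some !eqxx.
have /card_gt0P[l] := leq_ltn_trans (leq0n _) (leaves k).
rewrite !inE => /andP[leaf_l /eqP cl].
exists (V + bool)%type, (grow e l), (inl z), (c \o grow_origin l); split.
- exact: grow_tree.
- exact: grow_cubic.
- exact: grow_constant_off.
- move=> i; apply: leq_trans (card_grow_colored_leaves leaf_l c i).
  by rewrite /= cl -addnS leq_add2l.
Qed.

Lemma branch_width_of_nonspanning_cover (E : finType) (N : matroid E) :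
  covered_up_to 'I_3 (nonspanning N) 0 -> branch_width N <= rank N.
Proof.
case=> X nsX; rewrite leqn0 cards_eq0 => /eqP no_missed.
have in_some x : exists k, x \in X k.
  have /setP/(_ x) := no_missed; rewrite in_setC in_set0 => /negbFE/bigcupP[k].
  by exists k.
have [color colorP] := fin_all_exists in_some.
have [V [e [z [c [tree_e cubic_e const_c leaves]]]]] :=
  colored_cubic_tree_exists (codom color).
have [k|f inj_f fP] :=
    @color_preserving_injection E V _ (leaf e) color c.
  apply: leq_trans (ltnW (leaves k)).
  by rewrite cardsE -sum1_card -sum1_count big_image_cond.
pose D := BranchDecomposition tree_e cubic_e inj_f (fun x => (fP x).1).
apply/branch_width_leP; exists D; apply/width_le_rankP => u v euv.
have side (a b : bd_vertex D) :
    z \notin component e a b -> nonspanning N (displayed a b).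
  move=> zC; apply: nonspanning_sub (nsX (c a)); apply/subsetP => x.
  rewrite displayed_component => /(constant_off_component const_c zC) <-.
  by rewrite (fP x).2.
have [zC|/side ->//] := boolP (z \in component e u v).
by rewrite orbC side // -(componentC tree_e euv) in_setC zC.
Qed.

Section Expansion.

Variables (E : finType) (t : nat) (M : matroid E).

Let N := expansion t M.

Lemma blowupT : blowup t [set: E] = setT.
Proof. by apply/setP => p; rewrite !inE. Qed.

Lemma blowupC (A : {set E}) : ~: blowup t A = blowup t (~: A).
Proof. by apply/setP => p; rewrite !inE. Qed.

Lemma blowup_bigcup (K : finType) (A : K -> {set E}) :
  blowup t (\bigcup_k A k) = \bigcup_k blowup t (A k).
Proof.
apply/setP => p; rewrite inE.
by apply/bigcupP/bigcupP => -[k _]; rewrite ?inE => pA; exists k; rewrite ?inE.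
Qed.

Lemma rk_expansion (X : {set E * 'I_t}) :
  exists A, rk N X = t * rk M A + #|X :\: blowup t A|.
Proof.
have [cyclicN rkN] := expansionP t M; have [C + ->] := cyclic_flats_rank N X.
by rewrite cyclicN => /imsetP[A cyclicA ->]; exists A; rewrite rkN.
Qed.

Lemma rk_expansion_blowup (A : {set E}) : rk N (blowup t A) = t * rk M A.
Proof.
apply/eqP; rewrite eqn_leq; apply/andP; split.
  have [_ rkN] := expansionP t M; have [B cyclicB ->] := cyclic_flats_rank M A.
  by rewrite mulnDr -rkN // -card_blowup -blowupD rk_le_addD.
have [B ->] := rk_expansion (blowup t A).
by rewrite blowupD card_blowup -mulnDr leq_mul2l rk_le_addD orbT.
Qed.

Lemma rank_expansion : rank N = t * rank M.
Proof. by rewrite /rank -blowupT rk_expansion_blowup. Qed.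

Lemma nonspanning_expansionP (X : {set E * 'I_t}) :
  nonspanning N X <-> exists A, #|X :\: blowup t A| < t * corank M A.
Proof.
rewrite /nonspanning /corank rank_expansion; split=> [|[A]].
  by have [A ->] := rk_expansion X => lt; exists A; rewrite mulnBr; lia.
have := rk_le_addD N X (blowup t A); rewrite rk_expansion_blowup mulnBr.
by lia.
Qed.

Lemma nonspanning_cover_expansion (K : finType) (m : nat) :
  0 < t -> m * t <= #|K| * t.-1 -> covered_up_to K (nonspanning M) m ->
  covered_up_to K (nonspanning N) 0.
Proof.
move=> t_gt0 le_m [A nsA missed].
have [|B leB cover] := @extend_almost_cover K _ (fun k => blowup t (A k))
    (fun=> t.-1) 0.
  rewrite -blowup_bigcup blowupC card_blowup sum_nat_const addn0 mulnC.
  by apply: leq_trans le_m; rewrite leq_mul2r missed orbT.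
(* [t - 1] clones are too few to make [blowup t (A k)] spanning. *)
exists (fun k => blowup t (A k) :|: B k) => // k.
apply/nonspanning_expansionP; exists (A k).
rewrite setDUl setDv set0U; apply: (leq_ltn_trans (n := t.-1)).
  by apply: leq_trans (leB k); rewrite subset_leq_card // subsetDl.
by rewrite prednK // leq_pmulr // corank_gt0.
Qed.

Lemma proper_flat_cover_of_expansion (K : finType) (m : nat) :
  m < #|K| -> covered_up_to K (nonspanning N) m ->
  covered_up_to K (proper_flat M) #|K|.-1.
Proof.
move=> lt_m [X nsX missed].
have nsXP k := (nonspanning_expansionP (X k)).1 (nsX k).
have [A outside] := fin_all_exists nsXP.
apply: (@proper_flat_cover_of_corank _ _ _ A) => [k|].
  have := leq_ltn_trans (leq0n _) (outside k).
  by rewrite muln_gt0 corank_gt0 => /andP[].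
have card_outside : \sum_k #|X k :\: blowup t (A k)| + #|K| <=
    t * \sum_k corank M (A k).
  rewrite -sum1_card -big_split big_distrr; apply: leq_sum => k _ /=.
  by rewrite addn1.
have := leq_card_setC_bigcup X (fun k => blowup t (A k)).
rewrite -blowup_bigcup blowupC card_blowup => card_missed.
suff : t * #|~: \bigcup_k A k| < t * \sum_k corank M (A k).
  by rewrite ltn_mul2l => /andP[].
lia.
Qed.

End Expansion.

Theorem theorem6p3 (E : finType) (M : matroid E) :
  [<-> exists F1 F2 F3 : {set E},
         [/\ proper_flat M F1, proper_flat M F2, proper_flat M F3
           & #|[set: E] :\: (F1 :|: F2 :|: F3)| <= 2];
       forall t : nat, 3 <= t ->
         branch_width (expansion t M) <= rank (expansion t M);
       exists2 t : nat, 3 <= t &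
         branch_width (expansion t M) <= rank (expansion t M)]
  /\
  ((forall F1 F2 F3 A : {set E},
      proper_flat M F1 -> proper_flat M F2 -> proper_flat M F3 -> #|A| <= 2 ->
      [set: E] <> F1 :|: F2 :|: F3 :|: A) ->
   forall t : nat, 0 < t ->
     branch_width (expansion t M) = rank (expansion t M) + 1).
Proof.
have flats_of_width t : branch_width (expansion t M) <= rank (expansion t M) ->
    covered_up_to 'I_3 (proper_flat M) 2.
  move/nonspanning_cover_of_branch_width/proper_flat_cover_of_expansion.
  by rewrite card_ord; apply.
split.
  tfae.
  - move=> /three_proper_flatsP[F pfF missed] t t_ge3.
    apply: branch_width_of_nonspanning_cover.
    apply: (@nonspanning_cover_expansion _ _ _ _ 2);
      rewrite ?card_ord; [lia | lia |].
    by exists F => // k; apply: proper_flat_nonspanning.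
  - by move=> le_rank; exists 3; last exact: le_rank.
  - by move=> [t _ /flats_of_width/three_proper_flatsP].
move=> no_cover t _; apply/eqP.
rewrite addn1 eqn_leq branch_width_le_rankS ltnNge; apply/negP.
move=> /flats_of_width/three_proper_flatsP[F1 [F2 [F3 [pf1 pf2 pf3 missed]]]].
by apply: no_cover pf1 pf2 pf3 missed _; rewrite setTD setUCr.
Qed.
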